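(* Let $K$ be a field of prime characteristic $p>0$ and let $L=K(\theta)\simeq K[x]/(f(x))$ be a simple finite field extension of $K$, where $f(x)=f^{sep}(x^{p^n})=\sum_{i=0}^s\lambda_i x^{ip^n}\in K[x]$ (with $\lambda_i\in K$, $\lambda_s=1$) is the monic irreducible minimal polynomial of $\theta$ over $K$, written in its separable presentation. Then the following statements are equivalent: 1. $L=L^{pi}L^{sep}$ $\big(=L^{pi}\otimes_K L^{sep}\big)$. 2. $\lambda_i^{1/p^n}\in L$ for all $i=1,\ldots,s-1$; equivalently, $m_f=n$. 3. $L^{pi}=K\big(\lambda_0^{1/p^n},\ldots,\lambda_{s-1}^{1/p^n}\big)$.
   Context: Fix an algebraic closure $\overline{K}$ of $K$ containing all fields considered; $AB$ denotes the compositum in $\overline{K}$. For $\lambda\in\overline{K}$ and $k\ge 0$, $\lambda^{1/p^k}$ denotes the unique $p^k$-th root of $\lambda$ in $\overline{K}$. $L^{sep}$ and $L^{pi}$ are the maximal separable and the maximal purely inseparable subextensions of $L/K$; the identification $L^{pi}L^{sep}=L^{pi}\otimes_K L^{sep}$ is via the natural map $a\otimes b\mapsto ab$. Separable presentation: every non-scalar $f\in K[x]$ considered is written uniquely as $f(x)=f^{sep}(x^{p^n})$ with $f^{sep}\in K[x]$ a separable polynomial and $n\ge 0$; $n$ is the inseparability degree of $f$. Here $f^{sep}(x)=\sum_{i=0}^s\lambda_i x^i$. $m_f:=\max\{m'\in\{0,1,\ldots,n\}\mid \lambda_i^{1/p^{m'}}\in L\text{ for all } i=0,\ldots,s-1\}$.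 *)

(* Defs.v *)
From HB Require Import structures.
From mathcomp Require Import all_boot all_order all_algebra all_field.
From mathcomp Require Import boolp classical_sets.

Set Implicit Arguments.
Unset Strict Implicit.
Unset Printing Implicit Defensive.

Import GRing.Theory.
Local Open Scope classical_set_scope.
Local Open Scope ring_scope.

Section LargestSubextension.
Variables (K : fieldType) (L : fieldExtType K).

Definition largest_subfield (P : {subfield L} -> bool) : set {subfield L} :=
  [set E | P E /\ forall F : {subfield L}, P F -> (F <= E)%VS].

Definition sep_sub : {subfield L} :=
  xget 1%AS (largest_subfield (fun E => separable 1 E)).

Definition pi_sub : {subfield L} :=
  xget 1%AS (largest_subfield (fun E => purely_inseparable 1 E)).

(* The default value 1%AS of xget is never used: both subfields exist. *)
Lemma sep_subP : largest_subfield (fun E => separable 1 E) sep_sub.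
Proof.
apply: xgetPex; exists <<1%AS; separable_generator 1%AS {:L}%VS>>%AS; split.
  by rewrite -adjoin_separable_eq separable_generatorP.
move=> F sepF; apply/subvP => y Fy.
have sepy : separable_element 1%AS y by move/separableP: sepF; apply.
have /purely_inseparableP/(_ y (memvf y)) insepy :=
  separable_generator_maximal {:L}%VS (1%AS : {subfield L}).
rewrite -separable_inseparable_element insepy andbT.
by apply: separable_elementS sepy; apply: subv_adjoin.
Qed.

Lemma purely_inseparable_prodv (E F : {subfield L}) :
  purely_inseparable 1 E -> purely_inseparable 1 F ->
  purely_inseparable 1 (E * F)%AS.
Proof.
move=> /purely_inseparableP piE /purely_inseparableP piF.
apply/purely_inseparableP => y; rewrite /= unlock => /coord_span ->.
apply: (@inseparable_sum _ _ _ _ _ _ 1%AS) => i _.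
set X := allpairs_tuple _ _ _.
have /allpairsP[[u v] [/= uE vF ->]] : X`_i \in X.
  by apply: mem_nth; rewrite size_tuple.
have /piE/purely_inseparable_elementP_pchar[a ca Ea] := vbasis_mem uE.
have /piF/purely_inseparable_elementP_pchar[b cb Fb] := vbasis_mem vF.
apply/(@purely_inseparable_elementP_pchar _ _ 1%AS); exists (a * b)%N.
  by rewrite pnatM ca cb.
rewrite exprZn exprMn rpredZ //; apply: rpredM.
  by rewrite exprM rpredX.
by rewrite mulnC exprM rpredX.
Qed.

Lemma pi_subP : largest_subfield (fun E => purely_inseparable 1 E) pi_sub.
Proof.
apply: xgetPex.
pose Q d := `[< exists2 E : {subfield L},
  purely_inseparable 1 E & \dim E = d >].
have exQ : exists d, Q d.
  exists (\dim (1%AS : {subfield L})); apply/asboolP; exists 1%AS => //.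
  exact: purely_inseparable_refl.
have ubQ d : Q d -> (d <= \dim {:L})%N.
  by move=> /asboolP[E _ <-]; apply/dimvS/subvf.
case: (ex_maxnP exQ ubQ) => d /asboolP[E piE dimE] maxd.
exists E; split=> // F piF.
have sEF : (E <= E * F)%VS by apply: field_subvMr.
have sFE : (F <= E * F)%VS by apply: field_subvMl.
suff -> : (E : {vspace L}) = (E * F)%VS by [].
apply/eqP; rewrite eqEdim sEF dimE maxd //; apply/asboolP.
by exists (E * F)%AS => //; apply: purely_inseparable_prodv.
Qed.

End LargestSubextension.

Section TensorProduct.
Variable K : fieldType.

Definition is_tensor_product (U V T : lmodType K) (tau : U -> V -> T) : Prop :=
  bilinear_for *:%R *:%R tau /\
  forall (W : lmodType K) (beta : {bilinear U -> V -> W}),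
  exists g : {linear T -> W}, (forall u v, g (tau u v) = beta u v) /\
    (forall g' : {linear T -> W},
      (forall u v, g' (tau u v) = beta u v) -> g' =1 g).

(* vsproj only repackages vsval a * vsval b, which lies in E * F. *)
Definition compositum_mul (L : fieldExtType K) (E F : {subfield L})
    (a : subvs_of E) (b : subvs_of F) : subvs_of (E * F)%AS :=
  vsproj (E * F)%AS (vsval a * vsval b).

End TensorProduct.

Section FrobeniusRoot.

Definition pk_root (F : closedFieldType) (p k : nat) (x : F) : F :=
  xget 0 [set y | y ^+ (p ^ k) = x].

(* In characteristic p the root exists and is unique, so xget makes no choice. *)
Lemma pk_rootP (F : closedFieldType) (p k : nat) (x y : F) :
  p \in [pchar F] -> y ^+ (p ^ k) = x <-> y = pk_root p k x.
Proof.
move=> cF; have q0 : (0 < p ^ k)%N by rewrite expn_gt0 prime_gt0 ?(pcharf_prime cF).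
have rK : pk_root p k x ^+ (p ^ k) = x.
  apply: (@xgetPex _ 0 [set y | y ^+ (p ^ k) = x]).
  have := @solve_monicpoly F (p ^ k)%N (fun i => if i is 0%N then x else 0) q0.
  case=> z zE; exists z => /=; rewrite zE.
  rewrite -(prednK q0) big_ord_recl expr0 mulr1.
  by rewrite big1 ?addr0 // => i _; rewrite mul0r.
split=> [yK|->//]; apply/eqP; rewrite -subr_eq0.
have pq : [pchar F].-nat (p ^ k)%N.
  by rewrite pnatX pnatE ?(pcharf_prime cF) // cF.
have : (y - pk_root p k x) ^+ (p ^ k) == 0.
  by rewrite exprDn_pchar // exprNn_pchar // rK yK subrr.
by rewrite expf_eq0 q0.
Qed.

End FrobeniusRoot.

Section InsideClosure.
Variables (K : fieldType) (L : fieldExtType K) (Kbar : closedFieldType).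
Variable iota : {rmorphism L -> Kbar}.

Definition base_emb (a : K) : Kbar := iota (in_alg L a).

Definition adjoin (A : set Kbar) : set Kbar :=
  smallest (fun S : set Kbar => divring_closed (mem S)) (range base_emb `|` A).

(* With g = \sum_i lambda_i 'X^i, this is lambda_i ^ (1 / p ^ k). *)
Definition coef_root (p k : nat) (g : {poly K}) (i : nat) : Kbar :=
  pk_root p k (base_emb g`_i).

Definition max_root_exponent (p n : nat) (g : {poly K}) : nat :=
  \max_(m < n.+1 | [forall i : 'I_(size g).-1,
                      coef_root p m g i \in range iota]) m.

End InsideClosure.

(* Main.v *)
From HB Require Import structures.
Require Import Defs.
From mathcomp Require Import all_boot all_order all_algebra all_field.
From mathcomp Require Import boolp classical_sets.

(* A separable element keeps its degree over a purely inseparable extension,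
   because raising to a power p^k sends the coefficients of its minimal
   polynomial into K without changing the field the element generates.  Hence
   L^pi and L^sep are linearly disjoint and [L^pi L^sep : K] = [L^pi : K] s,
   where s = deg f^sep = [L^sep : K] since L^sep = K(theta^(p^n)).  The
   equivalences are then dimension counts: theta is a root of
   h = sum_i lambda_i^(1/p^n) x^i, so a subfield E of L containing these roots
   satisfies [L : E] <= s, while L = L^pi L^sep forces the minimal polynomial of
   theta over L^pi to have degree s and to equal h. *)

Set Implicit Arguments.
Unset Strict Implicit.
Unset Printing Implicit Defensive.

Import GRing.Theory.
Local Open Scope classical_set_scope.
Local Open Scope ring_scope.

(** * Frobenius twists of polynomials *)

Section FrobeniusPoly.
Variables (R : comNzRingType) (c : nat).
Hypothesis charRc : [pchar R].-nat c.

(** The Frobenius twist of [g]: evaluated at [x ^+ c] it gives the [c]-th power of [g.[x]]. *)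
Definition coef_expr (g : {poly R}) : {poly R} :=
  \poly_(i < size g) (g`_i ^+ c).

Let c_gt0 : (0 < c)%N. Proof. by case/andP: charRc. Qed.

Lemma coef_coef_expr g i : (coef_expr g)`_i = g`_i ^+ c.
Proof.
rewrite coef_poly; case: ltnP => // gi.
by rewrite (nth_default _ gi) expr0n gtn_eqF.
Qed.

Lemma expr_sum_pchar (I : Type) (r : seq I) (P : pred I) (F : I -> R) :
  (\sum_(i <- r | P i) F i) ^+ c = \sum_(i <- r | P i) F i ^+ c.
Proof.
apply: (big_morph (fun x => x ^+ c)) => [x y|]; first exact: exprDn_pchar.
by rewrite expr0n gtn_eqF.
Qed.

Lemma horner_coef_expr g x : (coef_expr g).[x ^+ c] = g.[x] ^+ c.
Proof.
rewrite horner_poly horner_coef expr_sum_pchar.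
by apply: eq_bigr => i _; rewrite exprMn exprAC.
Qed.

End FrobeniusPoly.

(** * Degrees over purely inseparable extensions *)

Section FieldExtensions.
Variables (K : fieldType) (L : fieldExtType K).
Implicit Types (E F : {subfield L}) (x : L) (r : {poly L}).

Lemma polyOver_small_root_eq0 E x r :
  r \is a polyOver E -> root r x -> (size r <= adjoin_degree E x)%N -> r = 0.
Proof.
move=> Er rx sr; apply/eqP/negPn/negP => r0.
by move: (dvdp_leq r0 (minPoly_dvdp Er rx)); rewrite size_minPoly ltnNge sr.
Qed.

Lemma adjoin_degree_le E x r :
  r \is a polyOver E -> root r x -> r != 0 ->
  (adjoin_degree E x <= (size r).-1)%N.
Proof.
move=> Er rx r0; move: (dvdp_leq r0 (minPoly_dvdp Er rx)).
by rewrite size_minPoly; case: (size r).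
Qed.

Lemma coef_minPoly_lead E x : (minPoly E x)`_(adjoin_degree E x) = 1.
Proof. by have /monicP := monic_minPoly E x; rewrite /lead_coef size_minPoly. Qed.

Section Characteristic.
Variables (p : nat) (charLp : p \in [pchar L]).

Lemma pnat_pchar_expn k : [pchar L].-nat (p ^ k)%N.
Proof. by rewrite pnatX pnatE ?charLp // (pcharf_prime charLp). Qed.

Lemma expr_pchar_inj k : injective (fun x : L => x ^+ (p ^ k)).
Proof.
move=> x y /= /eqP; rewrite -subr_eq0 => /eqP xy.
apply/eqP; rewrite -subr_eq0.
have : (x - y) ^+ (p ^ k) == 0.
  by rewrite exprDn_pchar ?exprNn_pchar ?pnat_pchar_expn // xy.
by rewrite expf_eq0 => /andP[].
Qed.

(** A basis of [E] is finite, so the product of the exponents of its vectors serves them all;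
    additivity of Frobenius extends this exponent to [E]. *)
Lemma purely_inseparable_exponent E : purely_inseparable 1 E ->
  exists k, forall x, x \in E -> x ^+ (p ^ k) \in (1%AS : {subfield L}).
Proof.
move=> /purely_inseparableP piE.
have bounded (s : seq L) : {subset s <= E} ->
    exists2 c, [pchar L].-nat c &
      {in s, forall x, x ^+ c \in (1%AS : {subfield L})}.
  elim: s => [|y s IHs] sE; first by exists 1%N.
  have [|c cc cs] := IHs; first by move=> x xs; apply: sE; rewrite inE xs orbT.
  have /piE/purely_inseparable_elementP_pchar[a ca ya] := sE y (mem_head _ _).
  exists (a * c)%N; first by rewrite pnatM ca cc.
  move=> x; rewrite inE => /predU1P[->|/cs xc]; first by rewrite exprM rpredX.
  by rewrite mulnC exprM rpredX.
have [|c cc cE] := bounded (vbasis E); first by move=> x /vbasis_mem.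
have /p_natP[k ck] : p.-nat c by rewrite -(eq_pnat _ (pcharf_eq charLp)).
exists k; rewrite -ck => x /coord_vbasis ->.
rewrite expr_sum_pchar //; apply: rpred_sum => i _.
by rewrite exprZn rpredZ // cE // mem_nth // size_tuple.
Qed.

(** By [pcharf_p_separable], a separable [x] is itself a member of the field generated by its power;
    this criterion needs a positive exponent, hence the case split on [k]. *)
Lemma adjoin_expr_separable E x k :
  separable_element E x -> <<E; x ^+ (p ^ k)>>%VS = <<E; x>>%VS.
Proof.
case: k => [|k]; first by rewrite expr1.
rewrite (pcharf_p_separable _ _ k charLp) => xk.
apply/eqP; rewrite eqEsubv; apply/andP; split; apply/FadjoinP; split=> //.
- exact: subv_adjoin.
- by rewrite rpredX // memv_adjoin.
- exact: subv_adjoin.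
Qed.

Lemma adjoin_degree_expr_separable E x k : separable_element E x ->
  adjoin_degree E (x ^+ (p ^ k)) = adjoin_degree E x.
Proof.
move=> sx; apply/eqP; rewrite -(eqn_pmul2r (adim_gt0 E)) -!dim_Fadjoin.
by rewrite adjoin_expr_separable.
Qed.

Lemma polyOver_coef_expr E k r :
  (forall x, x \in E -> x ^+ (p ^ k) \in (1%AS : {subfield L})) ->
  r \is a polyOver E -> coef_expr (p ^ k) r \is a polyOver (1%AS : {subfield L}).
Proof.
move=> Ek Er; apply/polyOverP => i.
by rewrite coef_coef_expr ?pnat_pchar_expn // Ek // (polyOverP Er).
Qed.

Lemma root_coef_expr k r x : root r x -> root (coef_expr (p ^ k) r) (x ^+ (p ^ k)).
Proof.
rewrite /root horner_coef_expr ?pnat_pchar_expn // expf_eq0 => ->.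
by rewrite expn_gt0 prime_gt0 // (pcharf_prime charLp).
Qed.

(* The coefficients of [minPoly E x] fall into [1] after raising to a power
   [p ^ k], while [x ^+ (p ^ k)] still has degree [adjoin_degree 1 x]. *)
Lemma adjoin_degree_purely_inseparable E x :
  purely_inseparable 1 E -> separable_element 1 x ->
  (adjoin_degree 1 x <= adjoin_degree E x)%N.
Proof.
move=> /purely_inseparable_exponent[k Ek] sx.
rewrite -(adjoin_degree_expr_separable k sx).
set r := coef_expr (p ^ k) (minPoly E x).
have r0 : r != 0.
  apply/eqP => r0.
  have := coef_coef_expr (pnat_pchar_expn k) (minPoly E x) (adjoin_degree E x).
  rewrite -/r r0 coef0 coef_minPoly_lead expr1n => /esym/eqP.
  by rewrite oner_eq0.
have r1 := polyOver_coef_expr Ek (minPolyOver E x).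
apply: leq_trans (adjoin_degree_le r1 _ r0) _.
  by apply: root_coef_expr; apply: root_minPoly.
by rewrite -subn1 leq_subLR add1n -size_minPoly size_poly.
Qed.

(** With [F = <<1; a>>] for a separable [a], the product contains [<<E; a>>], and the degree of [a]
    does not drop over [E]. *)
Lemma dim_prodv_disjoint E F :
  purely_inseparable 1 E -> separable 1 F ->
  \dim (E * F) = (\dim E * \dim F)%N.
Proof.
move=> piE sF; apply/eqP; rewrite eqn_leq dim_prodv /=.
have FE := eq_adjoin_separable_generator sF (sub1v F).
set a := separable_generator _ _ in FE.
rewrite FE dim_Fadjoin dimv1 muln1 mulnC.
apply: (@leq_trans (\dim <<E; a>>%VS)).
  rewrite dim_Fadjoin leq_mul2r adjoin_degree_purely_inseparable ?orbT //.
  exact: separable_generatorP.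
apply/dimvS/FadjoinP; split; first exact: field_subvMr.
by have := memv_mul (mem1v E) (memv_adjoin 1%AS a); rewrite mul1r.
Qed.

End Characteristic.
End FieldExtensions.

(** * The compositum of linearly disjoint subfields as a tensor product *)

Lemma eq_mxvec_index (m n : nat) (i i' : 'I_m) (j j' : 'I_n) :
  (mxvec_index i j == mxvec_index i' j') = (i == i') && (j == j').
Proof.
(* An entry of a flattened elementary matrix detects equality of indices; [rat] only serves as a
   ring with [1 != 0]. *)
have := mxvecE (delta_mx i' j' : 'M[rat]_(m, n)) i j.
by rewrite mxvec_delta !mxE eqxx /=; do 2 case: (_ == _); case: (_ == _).
Qed.

Section LinearlyDisjoint.
Variables (K : fieldType) (L : fieldExtType K) (E F : {subfield L}).
Hypothesis dimEF : \dim (E * F) = (\dim E * \dim F)%N.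

(** Flattening by [mxvec] turns pairs of basis indices into a single index, with [mxvec_index] as
    the dictionary. *)
Definition prod_basis : (\dim E * \dim F).-tuple L :=
  [tuple mxvec (\matrix_(i < \dim E, j < \dim F)
                   ((vbasis E)`_i * (vbasis F)`_j)) 0 k | k < \dim E * \dim F].

Lemma nth_prod_basis (i : 'I_(\dim E)) (j : 'I_(\dim F)) :
  prod_basis`_(mxvec_index i j) = (vbasis E)`_i * (vbasis F)`_j.
Proof. by rewrite -tnth_nth tnth_mktuple mxvecE mxE. Qed.

(** The products span, and by [dimEF] their number is the dimension. *)
Lemma prod_basisP : basis_of (E * F) prod_basis.
Proof.
rewrite basisEdim size_tuple dimEF leqnn andbT; apply/prodvP => u v Eu Fv.
rewrite (coord_vbasis Eu) (coord_vbasis Fv) mulr_suml.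
apply: rpred_sum => i _; rewrite mulr_sumr; apply: rpred_sum => j _.
rewrite -scalerAl -scalerAr !rpredZ // -nth_prod_basis memv_span //.
by rewrite mem_nth // size_tuple.
Qed.

Lemma coord_prod_basis (i i' : 'I_(\dim E)) (j j' : 'I_(\dim F)) :
  coord prod_basis (mxvec_index i' j') ((vbasis E)`_i * (vbasis F)`_j) =
  ((i == i') && (j == j'))%:R.
Proof.
by rewrite -nth_prod_basis coord_free ?(basis_free prod_basisP) // eq_mxvec_index.
Qed.

Lemma compositum_mulE (a : subvs_of E) (b : subvs_of F) :
  vsval (compositum_mul a b) = vsval a * vsval b.
Proof. by rewrite vsprojK //; apply: memv_mul; apply: subvsP. Qed.

Lemma compositum_mul_bilinear :
  bilinear_for *:%R *:%R (@compositum_mul K L E F).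
Proof.
split=> [b|a] c u v; apply: val_inj; rewrite /= !compositum_mulE /=.
  by rewrite mulrDl -scalerAl.
by rewrite mulrDr -scalerAr.
Qed.

Let bE i : subvs_of E := vsproj E (vbasis E)`_i.
Let bF j : subvs_of F := vsproj F (vbasis F)`_j.

Lemma subvs_coord (U : {vspace L}) (a : subvs_of U) :
  a = \sum_i coord (vbasis U) i (vsval a) *: vsproj U (vbasis U)`_i.
Proof.
apply: val_inj; rewrite /= linear_sum /= {1}(coord_vbasis (subvsP a)).
apply: eq_bigr => i _; rewrite vsprojK //.
by apply: vbasis_mem; rewrite mem_nth // size_tuple.
Qed.

Lemma vsval_bE (i : 'I_(\dim E)) : vsval (bE i) = (vbasis E)`_i.
Proof. by rewrite vsprojK // vbasis_mem // mem_nth // size_tuple. Qed.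

Lemma vsval_bF (j : 'I_(\dim F)) : vsval (bF j) = (vbasis F)`_j.
Proof. by rewrite vsprojK // vbasis_mem // mem_nth // size_tuple. Qed.

Lemma compositum_coord (x : subvs_of (E * F)%AS) :
  x = \sum_(i < \dim E) \sum_(j < \dim F)
        coord prod_basis (mxvec_index i j) (vsval x)
          *: compositum_mul (bE i) (bF j).
Proof.
apply: val_inj; rewrite /= {1}(coord_basis prod_basisP (subvsP x)).
rewrite (reindex _ (curry_mxvec_bij _ _)) linear_sum /=.
under [RHS]eq_bigr => i _ do rewrite linear_sum /=.
rewrite pair_bigA; apply: eq_bigr => -[i j] _ /=.
by rewrite compositum_mulE vsval_bE vsval_bF nth_prod_basis.
Qed.

Lemma bilinear_coord (W : lmodType K)
    (beta : {bilinear subvs_of E -> subvs_of F -> W}) a b :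
  beta a b = \sum_(i < \dim E) \sum_(j < \dim F)
    (coord (vbasis E) i (vsval a) * coord (vbasis F) j (vsval b))
       *: beta (bE i) (bF j).
Proof.
rewrite {1}(subvs_coord a) linear_sumlz; apply: eq_bigr => i _.
rewrite {1}(subvs_coord b) linear_sumr; apply: eq_bigr => j _.
by rewrite linearZr_LR linearZl_LR scalerA mulrC.
Qed.

Lemma coord_compositum_mul (a : subvs_of E) (b : subvs_of F)
    (i : 'I_(\dim E)) (j : 'I_(\dim F)) :
  coord prod_basis (mxvec_index i j) (vsval a * vsval b) =
  coord (vbasis E) i (vsval a) * coord (vbasis F) j (vsval b).
Proof.
rewrite {1}(coord_vbasis (subvsP a)) mulr_suml linear_sum /=.
rewrite (bigD1 i) //= [X in _ + X]big1 ?addr0 => [|i' ii'].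
  rewrite {1}(coord_vbasis (subvsP b)) mulr_sumr linear_sum /=.
  rewrite (bigD1 j) //= [X in _ + X]big1 ?addr0 => [|j' jj'].
    rewrite -scalerAl -scalerAr !linearZ /= coord_prod_basis !eqxx.
    by rewrite mulr1.
  rewrite -scalerAl -scalerAr !linearZ /= coord_prod_basis (negPf jj') andbF.
  by rewrite !mulr0.
rewrite {1}(coord_vbasis (subvsP b)) mulr_sumr linear_sum /= big1 // => j' _.
rewrite -scalerAl -scalerAr !linearZ /= coord_prod_basis (negPf ii').
by rewrite !mulr0.
Qed.

Section Lift.
Variables (W : lmodType K) (beta : {bilinear subvs_of E -> subvs_of F -> W}).

(** The values on products of basis vectors are forced by [beta], and these products form a
    basis. *)
Definition tensor_lift (x : subvs_of (E * F)%AS) : W :=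
  \sum_(i < \dim E) \sum_(j < \dim F)
     coord prod_basis (mxvec_index i j) (vsval x) *: beta (bE i) (bF j).

Lemma tensor_lift_linear : linear tensor_lift.
Proof.
move=> c x y; rewrite /tensor_lift scaler_sumr -big_split; apply: eq_bigr => i _.
rewrite /= scaler_sumr -big_split; apply: eq_bigr => j _ /=.
by rewrite linearP /= scalerDl scalerA.
Qed.

HB.instance Definition _ :=
  GRing.isLinear.Build K (subvs_of (E * F)%AS) W *:%R tensor_lift
    tensor_lift_linear.

Lemma tensor_liftE a b : tensor_lift (compositum_mul a b) = beta a b.
Proof.
rewrite bilinear_coord; apply: eq_bigr => i _; apply: eq_bigr => j _.
by rewrite compositum_mulE coord_compositum_mul.
Qed.

End Lift.

Lemma compositum_tensor_product : is_tensor_product (@compositum_mul K L E F).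
Proof.
split=> [|W beta]; first exact: compositum_mul_bilinear.
exists (tensor_lift beta); split=> [u v|g' g'E x]; first exact: tensor_liftE.
(* Uniqueness: every [x] is a combination of products of basis vectors, where [g'] agrees with
   [beta]. *)
rewrite {1}(compositum_coord x) linear_sum; apply: eq_bigr => i _.
rewrite linear_sum; apply: eq_bigr => j _.
by rewrite linearZ /= g'E.
Qed.

End LinearlyDisjoint.

(** The whole field [<<1; x>>] is purely inseparable, since the [p ^ k]-th power of [r.[x]] is the
    twist of [r] evaluated at [x ^+ (p ^ k)]; maximality of [pi_sub L] concludes. *)
Lemma mem_pi_sub (p : nat) (K : fieldType) (L : fieldExtType K) (k : nat) (x : L) :
  p \in [pchar L] -> x ^+ (p ^ k) \in (1%AS : {subfield L}) -> x \in pi_sub L.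
Proof.
move=> charLp xk; have /subvP -> // : (<<1; x>> <= pi_sub L)%VS.
  case: (pi_subP L) => _ -> //; apply/purely_inseparableP => y.
  move=> /Fadjoin_polyP[r r1 ->].
  apply/purely_inseparable_elementP_pchar; exists (p ^ k)%N.
    exact: pnat_pchar_expn.
  rewrite -horner_coef_expr ?pnat_pchar_expn // rpred_horner //.
  apply/polyOverP => i; rewrite coef_coef_expr ?pnat_pchar_expn // rpredX //.
  exact: (polyOverP r1).
exact: memv_adjoin.
Qed.

(** * The simple extension generated by [theta]: dimension counts and roots of coefficients *)

Section SimpleExtension.
Variables (p : nat) (K : fieldType) (L : fieldExtType K) (theta : L).
Hypothesis charLp : p \in [pchar L].
Hypothesis L_gen : <<1; theta>>%VS = {:L}%VS.
Variables (fsep : {poly K}) (n : nat).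
Hypothesis fsep_separable : separable_poly fsep.
Hypothesis f_min : map_poly (in_alg L) (fsep \Po 'X^(p ^ n)) = minPoly 1 theta.

Let q := (p ^ n)%N.
Let s := (size fsep).-1.
Let g := map_poly (in_alg L) fsep.

Lemma expn_pchar_gt0 k : (0 < p ^ k)%N.
Proof. by rewrite expn_gt0 prime_gt0 // (pcharf_prime charLp). Qed.

Let q_gt0 : (0 < q)%N := expn_pchar_gt0 n.

Lemma fsep_monic : fsep \is monic.
Proof.
have : fsep \Po 'X^q \is monic.
  by rewrite -(map_monic (in_alg L)) f_min monic_minPoly.
rewrite !monicE lead_coef_comp ?size_polyXn ?ltnS ?q_gt0 //.
by rewrite lead_coefXn expr1n mulr1.
Qed.

Lemma size_fsep : size fsep = s.+1.
Proof.
by rewrite prednK // lt0n size_poly_eq0 monic_neq0 // fsep_monic.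
Qed.

Lemma adjoin_degree_theta : adjoin_degree 1 theta = (s * q)%N.
Proof.
have := size_comp_poly fsep 'X^q.
by rewrite -(size_map_poly (in_alg L)) f_min size_minPoly size_polyXn.
Qed.

Lemma root_fsep : root g (theta ^+ q).
Proof.
have := root_minPoly 1%AS theta.
by rewrite -f_min map_comp_poly map_polyXn /root horner_comp hornerXn.
Qed.

Lemma separable_theta_expr : separable_element 1 (theta ^+ q).
Proof.
apply/separable_elementP; exists g; split; last by rewrite separable_map.
  exact: alg_polyOver.
exact: root_fsep.
Qed.

(** The polynomial [fsep] bounds the degree above. Below, substituting ['X^q] in the minimal
    polynomial of [theta ^+ q] kills [theta], whose degree is [s * q]. *)
Lemma adjoin_degree_theta_expr : adjoin_degree 1 (theta ^+ q) = s.
Proof.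
have g0 : g != 0 by rewrite map_poly_eq0 monic_neq0 // fsep_monic.
apply/eqP; rewrite eqn_leq; apply/andP; split.
  have := adjoin_degree_le (alg_polyOver 1%AS fsep) root_fsep g0.
  by rewrite size_map_poly.
set m := minPoly 1 (theta ^+ q).
have mq : (m \Po 'X^q) != 0.
  by rewrite comp_poly_eq0 ?size_polyXn ?ltnS ?q_gt0 // monic_neq0 ?monic_minPoly.
have := @adjoin_degree_le _ _ 1%AS theta _ _ _ mq.
rewrite size_comp_poly size_polyXn size_minPoly adjoin_degree_theta /=.
rewrite leq_pmul2r ?q_gt0 //; apply.
  by rewrite polyOver_comp ?minPolyOver // rpredX // polyOverX.
rewrite /root horner_comp hornerXn; exact: root_minPoly.
Qed.

(** A separable [y = r.[theta]] lies in the field generated by [y ^+ q], which is the twist of [r]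
    evaluated at [theta ^+ q]. *)
Lemma sep_sub_theta : (sep_sub L : {vspace L}) = <<1; theta ^+ q>>%VS.
Proof.
have [/separableP sepF maxF] := sep_subP L.
apply/eqP; rewrite eqEsubv; apply/andP; split; last first.
  by apply: maxF; rewrite -adjoin_separable_eq separable_theta_expr.
apply/subvP => y /sepF /(adjoin_expr_separable charLp n) yF.
have : y \in <<1; y>>%VS by exact: memv_adjoin.
rewrite -yF; apply: subvP; apply/FadjoinP; split; first exact: subv_adjoin.
have /Fadjoin_polyP[r r1 ->] : y \in <<1; theta>>%VS by rewrite L_gen memvf.
rewrite -horner_coef_expr ?pnat_pchar_expn //; apply: mempx_Fadjoin.
apply: (@polyOver_coef_expr _ _ _ charLp 1%AS) => // x; exact: rpredX.
Qed.

Lemma dim_sep_sub : \dim (sep_sub L) = s.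
Proof.
by rewrite sep_sub_theta dim_Fadjoin dimv1 muln1 adjoin_degree_theta_expr.
Qed.

Lemma dim_pi_sep : \dim (pi_sub L * sep_sub L) = (\dim (pi_sub L) * s)%N.
Proof.
rewrite -dim_sep_sub (dim_prodv_disjoint charLp) //.
  by case: (pi_subP L).
by case: (sep_subP L).
Qed.

Lemma adjoin_theta (E : {subfield L}) : <<E; theta>>%VS = {:L}%VS.
Proof.
apply/eqP; rewrite eqEsubv subvf -L_gen; apply/FadjoinP; split.
  exact: sub1v.
exact: memv_adjoin.
Qed.

Definition coefs_have_roots_in (E : {subfield L}) :=
  forall i, (i < s)%N -> exists2 u, u \in E & u ^+ q = (fsep`_i)%:A.

(* [\sum_i lambda_i ^ (1 / q) 'X^i] kills [theta], since its [q]-th power is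
   [f]. *)
Lemma dim_le_of_roots (E : {subfield L}) :
  coefs_have_roots_in E -> (\dim {:L} <= \dim E * s)%N.
Proof.
move=> rootsE.
(* The roots are continued by 1 at [s], as [fsep] is monic, and by 0 beyond, so that every [u i]
   lies in [E]. *)
have /choice[u uP] (i : nat) :
    exists u, u \in E /\ ((i <= s)%N -> u ^+ q = (fsep`_i)%:A).
  case: (ltngtP i s) => [/rootsE[u uE uq]|_|->]; first by exists u.
    by exists 0; rewrite rpred0.
  exists 1; rewrite rpred1 expr1n; split=> // _.
  by have /monicP := fsep_monic; rewrite /lead_coef -/s => ->; rewrite scale1r.
pose h := \poly_(i < s.+1) u i.
have hE : h \is a polyOver E.
  by apply/polyOverP => i;
     rewrite coef_poly; case: ifP => _; rewrite ?rpred0 ?(uP i).1.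
have hg : coef_expr q h = g.
  apply/polyP => i.
  rewrite coef_coef_expr ?pnat_pchar_expn // coef_map /= coef_poly.
  case: ltnP => [/(uP i).2 -> //|si].
  by rewrite nth_default ?size_fsep // expr0n gtn_eqF ?q_gt0 // scale0r.
have hroot : root h theta.
  have := root_fsep; rewrite -hg /root horner_coef_expr ?pnat_pchar_expn //.
  by rewrite expf_eq0 => /andP[].
have h0 : h != 0.
  apply/eqP => h0; have := coef_map (in_alg L) fsep s.
  rewrite -/g -hg h0 coef_coef_expr ?pnat_pchar_expn // coef0.
  have /monicP := fsep_monic; rewrite /lead_coef -/s => -> /=.
  rewrite expr0n gtn_eqF ?q_gt0 // scale1r => /esym/eqP.
  by rewrite oner_eq0.
rewrite -(adjoin_theta E) dim_Fadjoin mulnC leq_mul2l.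
apply/orP; right; apply: leq_trans (adjoin_degree_le hE hroot h0) _.
by rewrite -subn1 leq_subLR add1n size_poly.
Qed.

(* By dimension count [minPoly L^pi theta] has degree [s]; raising its
   coefficients to a large power [p ^ (n + k)] gives the minimal polynomial of
   [theta ^+ p ^ (n + k)] over [K], which is also obtained from [fsep] by
   raising coefficients to the power [p ^ k]. *)
Lemma roots_in_pi_sub : {:L}%VS = (pi_sub L * sep_sub L)%VS ->
  coefs_have_roots_in (pi_sub L).
Proof.
move=> Lprod; set E := pi_sub L.
have [piE _] := pi_subP L; have [k Ek] := purely_inseparable_exponent charLp piE.
have degE : adjoin_degree E theta = s.
  apply/eqP; rewrite -(eqn_pmul2r (adim_gt0 E)) -dim_Fadjoin adjoin_theta.
  by rewrite Lprod dim_pi_sep mulnC.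
set m := minPoly E theta.
have Enk x : x \in E -> x ^+ (p ^ (n + k)) \in (1%AS : {subfield L}).
  by move=> /Ek xk; rewrite addnC expnD exprM rpredX.
have r0 : coef_expr (p ^ (n + k)) m - coef_expr (p ^ k) g = 0.
  apply: (@polyOver_small_root_eq0 _ _ 1%AS (theta ^+ (p ^ (n + k)))).
  - rewrite rpredB ?(polyOver_coef_expr charLp Enk) ?minPolyOver //.
    apply: (@polyOver_coef_expr _ _ _ charLp 1%AS) => [x|]; first exact: rpredX.
    exact: alg_polyOver.
  - rewrite /root hornerD hornerN; apply/eqP.
    have /eqP -> := root_coef_expr charLp (n + k) (root_minPoly E theta).
    have /eqP := root_coef_expr charLp k root_fsep.
    by rewrite -exprM -expnD => ->; rewrite subrr.
  - have -> : theta ^+ (p ^ (n + k)) = (theta ^+ q) ^+ (p ^ k).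
      by rewrite expnD exprM.
    rewrite adjoin_degree_expr_separable ?separable_theta_expr //.
    (* Both twists are monic of degree [s], so their difference has degree below that of
       [theta ^+ (p ^ (n + k))]. *)
    rewrite adjoin_degree_theta_expr; apply/leq_sizeP => j; rewrite leq_eqVlt.
    rewrite coefB !coef_coef_expr ?pnat_pchar_expn // [g`_j]coef_map /=.
    case/predU1P => [<-|sj].
      rewrite -degE coef_minPoly_lead degE.
      have /monicP := fsep_monic; rewrite /lead_coef -/s => ->.
      by rewrite scale1r !expr1n subrr.
    rewrite !nth_default ?size_fsep ?size_minPoly ?degE //.
    by rewrite scale0r !expr0n !gtn_eqF ?expn_pchar_gt0 // subrr.
move=> i _; exists m`_i; first exact: (polyOverP (minPolyOver _ _)).
(* Injectivity of Frobenius removes the extra power [p ^ k] from the equality of coefficients. *)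
apply: (@expr_pchar_inj _ _ _ charLp k).
have /eqP := congr1 (fun r : {poly L} => r`_i) r0.
rewrite coefB coef0 subr_eq0 !coef_coef_expr ?pnat_pchar_expn // [g`_i]coef_map.
move/eqP.
by rewrite -exprM -expnD.
Qed.

Lemma pi_sep_full : coefs_have_roots_in (pi_sub L) ->
  {:L}%VS = (pi_sub L * sep_sub L)%VS.
Proof.
move=> /dim_le_of_roots dimL; apply/esym/eqP.
by rewrite eqEdim subvf dim_pi_sep.
Qed.

(** The roots are purely inseparable, which gives one inclusion. Equality follows from
    [\dim (pi_sub L) * s <= \dim {:L}], itself at most [s] times the dimension of the field
    generated by the roots. *)
Lemma pi_sub_adjoin_roots (u : nat -> L) :
  (forall i, (i < s)%N -> u i ^+ q = (fsep`_i)%:A) ->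
  (pi_sub L : {vspace L}) = <<1 & mkseq u s>>%VS.
Proof.
move=> uP; apply/esym/eqP; rewrite eqEdim; apply/andP; split.
  apply/Fadjoin_seqP; split=> [|x /mapP[i]]; first exact: sub1v.
  rewrite mem_iota add0n => /andP[_ /uP ui] ->.
  by apply: (mem_pi_sub (k := n) charLp); rewrite ui rpredZ // rpred1.
have [s0|s_gt0] := posnP s.
  have := adim_gt0 (sep_sub L); by rewrite dim_sep_sub s0.
rewrite -(leq_pmul2r s_gt0) -dim_pi_sep; apply: leq_trans (dimvS (subvf _)) _.
apply: (@dim_le_of_roots <<1 & mkseq u s>>%AS) => i si.
exists (u i); last exact: uP.
by apply: seqv_sub_adjoin; apply: map_f; rewrite mem_iota.
Qed.

(* [lambda_0] is redundant because [fsep.[theta ^+ q] = 0] expresses it through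
   the other coefficients and a [q]-th power. *)
Lemma roots_from_middle_coefs :
  (forall i, (0 < i <= s - 1)%N -> exists u : L, u ^+ q = (fsep`_i)%:A) ->
  coefs_have_roots_in {:L}%AS.
Proof.
move=> mid.
(* Index [s] is included with root 1, so that the sum below also covers the leading term. *)
have /choice[u uP] (i : nat) :
    exists u : L, (0 < i <= s)%N -> u ^+ q = (fsep`_i)%:A.
  case: (ltngtP i s) => [is_|_|->]; last 1 first.
  - exists 1 => _; rewrite expr1n.
    by have /monicP := fsep_monic; rewrite /lead_coef -/s => ->; rewrite scale1r.
  - have [->|i0] := posnP i; first by exists 0.
    have [|u uq] := mid i; last by exists u.
    by rewrite i0 /= leq_subRL ?add1n // (leq_trans _ is_).
  - by exists 0; rewrite andbF.
case=> [|i] is_; last first.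
  by exists (u i.+1); rewrite ?memvf // uP //= ltnW.
(* The [q]-th power of this witness is minus the sum of the nonconstant terms of [fsep] at
   [theta ^+ q], that is, the constant coefficient. *)
exists (- \sum_(i < s) u i.+1 * theta ^+ i.+1); first exact: memvf.
have charc := pnat_pchar_expn charLp n.
rewrite exprNn_pchar // expr_sum_pchar //.
have /eqP := root_fsep; rewrite horner_coef size_map_poly size_fsep.
rewrite big_ord_recl expr0 mulr1 coef_map addrC => /addr0_eq /= <-; congr (- _).
apply: eq_bigr => i _.
by rewrite exprMn uP ?ltn_ord // [g`_i.+1]coef_map /= exprAC /bump add1n.
Qed.

End SimpleExtension.

(** * Transfer to the algebraic closure *)

Section Closure.
Variables (K : fieldType) (L : fieldExtType K) (Kbar : closedFieldType).
Variable iota : {rmorphism L -> Kbar}.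

(** Roots in [Kbar] are unique and [iota] is injective, so the equation may be checked in [L]. *)
Lemma coef_rootP (p k : nat) (g : {poly K}) (i : nat) (u : L) :
  p \in [pchar L] ->
  u ^+ (p ^ k) = (g`_i)%:A <-> iota u = coef_root iota p k g i.
Proof.
move=> charLp; have charKbar : p \in [pchar Kbar] by rewrite (fmorph_pchar iota).
rewrite /coef_root -pk_rootP // -rmorphXn /base_emb /=.
by split=> [->|/fmorph_inj].
Qed.

Lemma coef_root_in_range (p k : nat) (g : {poly K}) (i : nat) :
  p \in [pchar L] ->
  reflect (exists u : L, u ^+ (p ^ k) = (g`_i)%:A)
          (coef_root iota p k g i \in range iota).
Proof.
move=> charLp; apply: (iffP idP) => [/set_mem|].
  by case=> u _ /coef_rootP uE; exists u; apply: uE.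
by case=> u uE; apply: mem_set; exists u => //; apply/coef_rootP.
Qed.

Lemma adjoin_roots (s : nat) (u : nat -> L) (lam : nat -> Kbar) (E : {subfield L}) :
  (forall i, (i < s)%N -> iota (u i) = lam i) ->
  (E : {vspace L}) = <<1 & mkseq u s>>%VS ->
  iota @` [set x | x \in E] = adjoin iota [set lam i | i in `I_s].
Proof.
move=> ulam EE; apply/seteqP; split.
  move=> _ [x /= xE <-] S [[S1 SB SV] SG].
  (* [divring_closed] gives only 1, differences and quotients; 0, sums and products are derived from
     them. *)
  have S0 : 0 \in (mem S : pred Kbar) by rewrite -(subrr 1) SB.
  have SD a b : a \in mem S -> b \in mem S -> a + b \in mem S.
    move=> aS bS; rewrite -[b]opprK SB // -[- b]sub0r; exact: SB.
  have SM a b : a \in mem S -> b \in mem S -> a * b \in mem S.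
    move=> aS bS; rewrite -[b]invrK SV // -[b^-1]mul1r; exact: SV.
  (* The base field [U] is kept general because the induction adjoins one generator at a time. *)
  have closed (rs : seq L) : forall U : {subfield L},
      (forall y, y \in U -> iota y \in mem S) ->
      (forall y, y \in rs -> iota y \in mem S) ->
      forall y, y \in <<U & rs>>%VS -> iota y \in mem S.
    elim: rs => [|z rs IHrs] U US rsS y.
      by rewrite adjoin_nil subfield_closed; apply: US.
    rewrite adjoin_cons; apply: (IHrs <<U; z>>%AS); last first.
      by move=> w wrs; apply: rsS; rewrite inE wrs orbT.
    move=> _ /Fadjoin_polyP[r rU ->]; rewrite horner_coef rmorph_sum.
    apply: (big_ind (fun w => w \in mem S)) => // i _.
    rewrite rmorphM rmorphXn; apply: (SM _ _); first by apply/US/(polyOverP rU).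
    elim: (nat_of_ord i) => [|j IHj]; first by rewrite expr0.
    by rewrite exprS; apply: SM => //; apply: rsS; rewrite mem_head.
  move: xE; rewrite EE => xE; apply/set_mem; apply: (closed _ 1%AS) xE.
    by move=> y /vlineP[a ->]; rewrite inE; apply: SG; left; exists a.
  move=> y /mapP[i]; rewrite mem_iota add0n => /andP[_ si] ->.
  by rewrite inE; apply: SG; right; exists i => //; rewrite -ulam.
(* Conversely, the image of [E] is itself a division ring containing the generators. *)
apply: smallest_sub => [|_ [[a _ <-]|[i /= si <-]]].
- split=> [
         |_ _ /set_mem[x xE <-] /set_mem[y yE <-]
         |_ _ /set_mem[x xE <-] /set_mem[y yE <-]].
  + by rewrite inE; exists 1; rewrite ?rmorph1 //= rpred1.
  + by rewrite inE; exists (x - y); rewrite ?rmorphB //= rpredB.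
  + by rewrite inE; exists (x / y); rewrite ?fmorph_div //= rpred_div.
- by exists (a%:A); rewrite //= rpredZ // rpred1.
- exists (u i); last exact: ulam.
  by rewrite /= EE seqv_sub_adjoin // map_f // mem_iota.
Qed.

Lemma max_root_exponentP (p n : nat) (g : {poly K}) : p \in [pchar L] ->
  max_root_exponent iota p n g = n <->
  forall i, (i < (size g).-1)%N -> exists u : L, u ^+ (p ^ n) = (g`_i)%:A.
Proof.
move=> charLp.
pose P (m : 'I_n.+1) :=
  [forall i : 'I_(size g).-1, coef_root iota p m g i \in range iota].
split=> [maxn i si|roots].
  (* The exponent 0 always qualifies, so the maximum is attained by some admissible [m], not by the
     default of an empty maximum. *)
  have P0 : P ord0.
    apply/forallP => j; apply/coef_root_in_range => //.
    by exists (g`_j)%:A; rewrite expr1.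
  have [|m Pm] := @eq_bigmax_cond _ P (fun m => m : nat).
    by apply/card_gt0P; exists ord0.
  rewrite -[LHS]/(max_root_exponent iota p n g) maxn => nm.
  move: Pm; rewrite unfold_in => /forallP/(_ (Ordinal si)).
  by rewrite -nm => /coef_root_in_range; apply.
apply/eqP; rewrite eqn_leq; apply/andP; split.
  by apply/bigmax_leqP => m _; rewrite -ltnS.
have Pn : P ord_max.
  by apply/forallP => i; apply/coef_root_in_range => //; apply: roots.
exact: (@leq_bigmax_cond _ P (fun m => m : nat) ord_max Pn).
Qed.

End Closure.

Theorem theorem2p8 (p : nat) (K : fieldType) (pcharK : p \in [pchar K])
    (L : fieldExtType K) (Kbar : closedFieldType)
    (iota : {rmorphism L -> Kbar})
    (Kbar_alg : forall z : Kbar, algebraicOver (base_emb iota) z)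
    (theta : L) (L_gen : <<1; theta>>%VS = {:L}%VS)
    (f : {poly K}) (f_min : map_poly (in_alg L) f = minPoly 1 theta)
    (fsep : {poly K}) (n : nat) (fsep_separable : separable_poly fsep)
    (f_pres : f = fsep \Po 'X^(p ^ n)) :
  is_tensor_product (@compositum_mul K L (pi_sub L) (sep_sub L)) /\
  [<-> {:L}%VS = (pi_sub L * sep_sub L)%VS;
       forall i : nat, (1 <= i <= (size fsep).-1 - 1)%N ->
         coef_root iota p n fsep i \in range iota;
       max_root_exponent iota p n fsep = n;
       iota @` [set x | x \in pi_sub L] =
         adjoin iota [set coef_root iota p n fsep i | i in `I_(size fsep).-1]].
Proof.
have charLp : p \in [pchar L] by rewrite pchar_lalg.
rewrite {}f_pres in f_min.
split.
  apply: compositum_tensor_product; apply: (dim_prodv_disjoint charLp).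
    by case: (pi_subP L).
  by case: (sep_subP L).
tfae.
- move=> /(roots_in_pi_sub charLp L_gen fsep_separable f_min) roots i /andP[i0 si].
  (* The subtraction is truncated; [i0] excludes a zero degree. *)
  have is_ : (i < (size fsep).-1)%N.
    rewrite (leq_ltn_trans si) // subn1 prednK // (leq_trans i0) //.
    by rewrite (leq_trans si) // leq_subr.
  have [u _ uq] := roots i is_.
  by apply/coef_root_in_range => //; exists u.
- move=> mid; apply/max_root_exponentP => // i si.
  have [|u _ uq] := roots_from_middle_coefs charLp f_min _ si; last by exists u.
  by move=> j /mid/coef_root_in_range; apply.
- move=> /(max_root_exponentP _ _ _ charLp) roots.
  have /choice[u uP] (i : nat) : exists u : L,
      (i < (size fsep).-1)%N -> u ^+ (p ^ n) = (fsep`_i)%:A.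
    case: ltnP => [/roots[u uq]|_]; first by exists u.
    by exists 0.
  apply: (@adjoin_roots _ _ _ _ _ u) => [i /uP /coef_rootP|]; first exact.
  exact: (pi_sub_adjoin_roots charLp L_gen fsep_separable f_min).
- move=> piE; apply: (pi_sep_full charLp L_gen fsep_separable f_min) => i si.
  (* Each root is among the generators, so by [piE] it comes from an element of [pi_sub L]. *)
  have : adjoin iota [set coef_root iota p n fsep i | i in `I_(size fsep).-1]
           (coef_root iota p n fsep i).
    by apply: sub_gen_smallest; right; exists i.
  rewrite -piE => -[u /= uE /coef_rootP uq]; exists u => //; exact: uq.
Qed.
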